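(* Let $k\ge 2$ be an integer, $\Delta$ a finite set, and $f:\mathbb N\to\Delta$ a $k$-automatic sequence, identified with the right-infinite word $\mathbf w=f(0)f(1)f(2)\cdots$ over $\Delta$. Then the Lie complexity function $(L_{\mathbf w}(n))_{n\ge 0}$ is a $k$-automatic sequence.
   Context: A sequence $(s_n)_{n\ge0}$ is $k$-automatic if there is a deterministic finite automaton with output which, on input the base-$k$ representation of $n$, ends in a state whose output is $s_n$. A factor of $\mathbf w$ is a finite block of contiguous symbols (empty word included); $\mathrm{Fac}(\mathbf w)$ is the set of factors. Two words are cyclically equivalent if each is a cyclic shift of the other; $[v]_C$ is the class of $v$. The Lie complexity is $L_{\mathbf w}(n)=\#\{[v]_C : |v|=n,\ [v]_C\subseteq \mathrm{Fac}(\mathbf w)\}$. *)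

(* Defs.v *)
From mathcomp Require Import all_boot.
From mathcomp Require Import boolp.
Set Implicit Arguments. Unset Strict Implicit. Unset Printing Implicit Defensive.

(* Base-k digits of n, least significant first; canonical (no leading zeros),
   so 0 has the empty representation.  Fuel n suffices since k >= 2. *)
Fixpoint digits_lsd_aux (k fuel n : nat) : seq nat :=
  match fuel with
  | 0 => [::]
  | fuel'.+1 => if n == 0 then [::] else (n %% k) :: digits_lsd_aux k fuel' (n %/ k)
  end.

Definition base_rep (k n : nat) : seq nat := rev (digits_lsd_aux k n n).

Definition automatic (k : nat) (T : Type) (s : nat -> T) : Prop :=
  exists (Q : finType) (q0 : Q) (delta : Q -> nat -> Q) (tau : Q -> T),
    forall n, tau (foldl delta q0 (base_rep k n)) = s n.

Definition is_factor (Delta : Type) (f : nat -> Delta) (v : seq Delta) : Prop :=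
  exists i, v = mkseq (fun j => f (i + j)) (size v).

Definition cyc_equiv (Delta : eqType) (v u : seq Delta) : bool :=
  [exists r : 'I_(size v).+1, u == rot r v].

Definition class_in_fac (Delta : eqType) (f : nat -> Delta) (v : seq Delta) : Prop :=
  forall u, cyc_equiv v u -> is_factor f u.

Definition cyc_class (Delta : finType) (n : nat) (v : n.-tuple Delta)
  : {set n.-tuple Delta} :=
  [set u : n.-tuple Delta | cyc_equiv v u].

Definition lie_complexity (Delta : finType) (f : nat -> Delta) (n : nat) : nat :=
  #|[set cyc_class v | v in [set v : n.-tuple Delta | `[< class_in_fac f v >]]]|.

(* Main.v *)
Require Import Defs.
From mathcomp Require Import all_boot.
From mathcomp Require Import boolp zify.

(* L(n) counts the positions i at which the length-n window lies in a conjugacy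
   class contained in Fac(w) and is conjugate to no earlier window.  This is a
   first-order condition on (n, i) using addition and the letters of w, so each
   set {n | c <= L(n)} is k-automatic, and it remains to bound L.

   The number of factors of length n is O(n), so it suffices to attach about n/4
   factors of length n injectively to all classes but O(1).  If v has no cyclic
   period d <= n/4, its first rotations are distinct.  If it has one, follow an
   occurrence of v until the periodicity first breaks at some position: the
   windows having that position among their last n/4 or so letters determine,
   by Fine-Wilf, the class of v and where the break is.  If it never breaks, w is
   eventually periodic with period v, which leaves a single class. *)

Set Implicit Arguments. Unset Strict Implicit. Unset Printing Implicit Defensive.

(** * Automatic sequences through states indexed by integers *)

Lemma digits_lsd_aux_fuel (k fuel n : nat) :
  2 <= k -> n <= fuel -> digits_lsd_aux k fuel n = digits_lsd_aux k n n.
Proof.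
move=> k2; elim/ltn_ind: n fuel => n IH [|fuel] le_n; first by case: n le_n IH.
case: n IH le_n => [//|n] IH le_n /=.
have lt_div : n.+1 %/ k < n.+1 by rewrite ltn_Pdiv.
by congr (_ :: _); rewrite IH ?[RHS]IH //; lia.
Qed.

Lemma base_rep_rcons (k n d : nat) : 2 <= k -> d < k -> 0 < k * n + d ->
  base_rep k (k * n + d) = rcons (base_rep k n) d.
Proof.
move=> k2 dk; rewrite /base_rep; case def_m: (k * n + d) => [//|m] _ /=.
have kgt0 : 0 < k by lia.
rewrite -def_m rev_cons mulnC divnMDl // (divn_small dk) addn0.
rewrite modnMDl modn_small // digits_lsd_aux_fuel //.
by rewrite -ltnS -def_m; nia.
Qed.

(** Turns runs over digit words into a recursion on integers. The recursion covers $n=d=0$, so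
    [st 0] is fixed by the digit 0, which the initial state [q0] need not be. *)
Lemma automaticP (k : nat) (T : Type) (s : nat -> T) : 2 <= k ->
  automatic k s <->
  exists (Q : finType) (st : nat -> Q) (delta : Q -> nat -> Q) (tau : Q -> T),
    (forall n d, d < k -> st (k * n + d) = delta (st n) d) /\
    forall n, tau (st n) = s n.
Proof.
move=> k2; split=> [[Q [q0 [delta [tau run]]]]|[Q [st [delta [tau [stD sE]]]]]].
  (* The extra state [None] absorbs leading zeros. *)
  exists (option Q).
  exists (fun n => if n == 0 then None else Some (foldl delta q0 (base_rep k n))).
  exists (fun q d => if q is Some p then Some (delta p d)
                     else if d == 0 then None else Some (delta q0 d)).
  exists (fun q => if q is Some p then tau p else tau q0).
  split=> [n d dk|n]; last by case: eqP => [->|_]; rewrite -run.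
  have [->|n_gt0] := posnP n.
    rewrite muln0 add0n; have [//|d_gt0] := posnP d.
    by have := @base_rep_rcons k 0 d k2 dk; rewrite muln0 add0n => ->.
  have m_gt0 : 0 < k * n + d by nia.
  by rewrite eqn0Ngt m_gt0 /= base_rep_rcons // foldl_rcons.
exists Q, (st 0), delta, tau => n; rewrite -sE; congr tau.
elim/ltn_ind: n => n IH; have [->//|n_gt0] := posnP n.
have lt_mod : n %% k < k by rewrite ltn_mod; lia.
rewrite (divn_eq n k) mulnC base_rep_rcons //; last by lia.
by rewrite foldl_rcons IH ?ltn_Pdiv // stD.
Qed.

Lemma automatic_comp2 (k : nat) (S T U : Type) (g : S -> T -> U)
    (s : nat -> S) (t : nat -> T) :
  2 <= k -> automatic k s -> automatic k t ->
  automatic k (fun n => g (s n) (t n)).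
Proof.
move=> k2 /(automaticP _ k2) [P [p [dp [tp [pD pE]]]]].
move=> /(automaticP _ k2) [Q [q [dq [tq [qD qE]]]]].
apply/(automaticP _ k2); exists (P * Q)%type, (fun n => (p n, q n)).
exists (fun u d => (dp u.1 d, dq u.2 d)), (fun u => g (tp u.1) (tq u.2)).
by split=> [n d dk|n] /=; rewrite ?pD ?qD ?pE ?qE.
Qed.

Lemma automatic_const (k : nat) (T : Type) (c : T) : automatic k (fun=> c).
Proof. by exists unit, tt, (fun _ _ => tt), (fun=> c). Qed.

(** * Recognizable relations and their closure properties *)

(* A relation on [N^omega] is recognizable when it belongs to a finite family
   of relations closed under [R |-> (x |-> R (k x + d))] for digit vectors
   [d].  This is a finite automaton reading least significant digits first;
   as it reads no words, leading zeros do not matter. *)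
Definition recognizable (k : nat) (R : (nat -> nat) -> Prop) : Prop :=
  exists (Q : finType) (q0 : Q) (step : Q -> (nat -> nat) -> Q)
         (P : Q -> (nat -> nat) -> Prop),
    (forall x, P q0 x <-> R x) /\
    forall q d x, (forall i, d i < k) ->
      P (step q d) x <-> P q (fun i => k * x i + d i).

Lemma recognizable_ext (k : nat) (R S : (nat -> nat) -> Prop) :
  (forall x, R x <-> S x) -> recognizable k R -> recognizable k S.
Proof.
move=> RS [Q [q0 [step [P [P0 PD]]]]]; exists Q, q0, step, P; split=> // x.
by rewrite P0 RS.
Qed.

Lemma recognizable_not (k : nat) (R : (nat -> nat) -> Prop) :
  recognizable k R -> recognizable k (fun x => ~ R x).
Proof.
move=> [Q [q0 [step [P [P0 PD]]]]].
exists Q, q0, step, (fun q x => ~ P q x).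
by split=> [x|q d x dk]; rewrite ?P0 ?PD.
Qed.

Lemma recognizable_and (k : nat) (R S : (nat -> nat) -> Prop) :
  recognizable k R -> recognizable k S -> recognizable k (fun x => R x /\ S x).
Proof.
move=> [Q1 [q1 [step1 [P1 [P10 P1D]]]]] [Q2 [q2 [step2 [P2 [P20 P2D]]]]].
exists (Q1 * Q2)%type, (q1, q2), (fun q d => (step1 q.1 d, step2 q.2 d)).
exists (fun q x => P1 q.1 x /\ P2 q.2 x).
by split=> [x|q d x dk] /=; rewrite ?P10 ?P20 ?P1D ?P2D.
Qed.

Lemma recognizable_imply (k : nat) (R S : (nat -> nat) -> Prop) :
  recognizable k R -> recognizable k S -> recognizable k (fun x => R x -> S x).
Proof.
move=> recR recS; apply: (@recognizable_ext _ (fun x => ~ (R x /\ ~ S x))).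
  move=> x; split=> [nRS Rx|RS [Rx]]; last by apply; apply: RS.
  by apply: contrapT => nSx; apply: nRS.
by apply/recognizable_not/recognizable_and/recognizable_not.
Qed.

(** Variables are de Bruijn indices: a quantifier binds variable 0 and shifts the others, whence
    [x i.+1] and [b.+1] below. *)
Definition scons (y : nat) (x : nat -> nat) (i : nat) : nat :=
  if i is j.+1 then x j else y.

(* Existential quantification is the subset construction. *)
Lemma recognizable_ex (k : nat) (R : (nat -> nat) -> nat -> Prop) : 2 <= k ->
  recognizable k (fun x => R (fun i => x i.+1) (x 0)) ->
  recognizable k (fun x => exists y, R x y).
Proof.
move=> k2 [Q [q0 [step [P [P0 PD]]]]]; have kgt0 : 0 < k by lia.
exists {set Q}, [set q0].
exists (fun (S : {set Q}) d => [set step u.1 (scons (u.2 : 'I_k) d)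
                             | u in setX S setT]).
exists (fun (S : {set Q}) x => exists q y, q \in S /\ P q (scons y x)).
split=> [x|S d x dk].
  split=> [[q [y [/set1P-> /P0]]]|[y Rxy]]; first by exists y.
  by exists q0, y; rewrite set11 P0.
have sdk (e : 'I_k) i : scons e d i < k by case: i => /=.
have sconsD y (e : 'I_k) : (fun i => k * scons y x i + scons e d i)
    = scons (k * y + e) (fun i => k * x i + d i) by apply/funext=> -[].
split=> [[_ [y [/imsetP[[q e] /setXP[/= qS _] ->] Pq]]]|[q [y [qS Pq]]]].
  by exists q, (k * y + e); split=> //; rewrite -sconsD -PD.
pose e := Ordinal (ltn_pmod y kgt0).
exists (step q (scons e d)), (y %/ k); split.
  by apply/imsetP; exists (q, e) => //; rewrite !inE qS.
by rewrite PD // sconsD /= mulnC -divn_eq.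
Qed.

Lemma recognizable_all (k : nat) (R : (nat -> nat) -> nat -> Prop) : 2 <= k ->
  recognizable k (fun x => R (fun i => x i.+1) (x 0)) ->
  recognizable k (fun x => forall y, R x y).
Proof.
move=> k2 recR.
apply: (@recognizable_ext _ (fun x => ~ exists y, ~ R x y)).
  move=> x; split=> [nR y|Rx [y]]; last by apply; apply: Rx.
  by apply: contrapT => nRy; apply: nR; exists y.
by apply/recognizable_not/recognizable_ex/recognizable_not.
Qed.

Lemma eq_muln_addn (k a c s e : nat) : e < k ->
  (k * a + s = k * c + e) <-> (s %% k = e /\ a + s %/ k = c).
Proof.
move=> ek; have kgt0 : 0 < k by lia.
split=> [eq_sum|[<- <-]]; last by rewrite mulnDr -addnA [k * (_ %/ _)]mulnC -divn_eq.
split.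
  have /(congr1 (modn^~ k)) := eq_sum.
  by rewrite ![k * _]mulnC !modnMDl (modn_small ek).
have /(congr1 (divn^~ k)) := eq_sum.
by rewrite ![k * _]mulnC !divnMDl // (divn_small ek) addn0.
Qed.

(* The states are the carries. *)
Lemma recognizable_add (k : nat) (a b c : nat) : 2 <= k ->
  recognizable k (fun x => x a + x b = x c).
Proof.
move=> k2; have kgt0 : 0 < k by lia.
exists (option bool), (Some false).
exists (fun (q : option bool) d => if q is Some r then
  if (d a + d b + r) %% k == d c then Some (k <= d a + d b + r) else None
  else None).
exists (fun (q : option bool) x =>
  if q is Some r then x a + x b + nat_of_bool r = x c else False).
split=> [x|[r|] d x dk] //; first by rewrite addn0.
set s := d a + d b + r.
have -> : k * x a + d a + (k * x b + d b) + r = k * (x a + x b) + s.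
  by rewrite /s; lia.
rewrite eq_muln_addn //.
have -> : s %/ k = (k <= s).
  (* Two digits and a carry sum to less than $2k$, so the next carry is again 0 or 1. *)
  have s2k : s < k + k by have [] := (dk a, dk b); rewrite /s; case: (r); lia.
  have [lt_sk|le_ks] := ltnP s k; first by rewrite divn_small.
  by rewrite -(subnK le_ks) divnDr ?dvdnn // divnn kgt0 divn_small //; lia.
by case: eqP => [e|ne] /=; split=> // -[].
Qed.

Lemma recognizable_le (k : nat) (a b : nat) : 2 <= k ->
  recognizable k (fun x => x a <= x b).
Proof.
move=> k2; apply: (@recognizable_ext _ (fun x => exists y, x a + y = x b)).
  by move=> x; split=> [[y <-]|le_ab]; [lia|exists (x b - x a); lia].
exact/recognizable_ex/recognizable_add.
Qed.

Lemma recognizable_lt (k : nat) (a b : nat) : 2 <= k ->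
  recognizable k (fun x => x a < x b).
Proof.
move=> k2; apply: (@recognizable_ext _ (fun x => ~ x b <= x a)).
  by move=> x; lia.
exact/recognizable_not/recognizable_le.
Qed.

(** Atomic relations only take variables; a sum becomes an argument by naming it with a fresh
    variable 0. *)
Lemma recognizable_let_add (k : nat) (a b : nat)
    (R : (nat -> nat) -> nat -> Prop) : 2 <= k ->
  recognizable k (fun x => R (fun i => x i.+1) (x 0)) ->
  recognizable k (fun x => R x (x a + x b)).
Proof.
move=> k2 recR.
apply: (@recognizable_ext _ (fun x => exists y, x a + x b = y /\ R x y)).
  by move=> x; split=> [[y [<-]]|Rx] //; exists (x a + x b).
exact/recognizable_ex/recognizable_and/recR/recognizable_add.
Qed.

(** Digits arrive least significant first, against the direction of [st]. So a state is a set of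
    pairs of states, starting with the pairs of equal output and pulled back along [delta]. *)
Lemma recognizable_automatic_eq (k : nat) (T : Type) (f : nat -> T) (a b : nat) :
  2 <= k -> automatic k f -> recognizable k (fun x => f (x a) = f (x b)).
Proof.
move=> k2 /(automaticP _ k2) [Q [st [delta [tau [stD fE]]]]].
exists {set Q * Q}, [set u | `[< tau u.1 = tau u.2 >]].
exists (fun (S : {set Q * Q}) d => [set u | (delta u.1 (d a), delta u.2 (d b)) \in S]).
exists (fun (S : {set Q * Q}) x => (st (x a), st (x b)) \in S).
split=> [x|S d x dk]; last by rewrite inE !stD.
by rewrite inE -!fE; split=> /asboolP.
Qed.

(* Recording, for every state of the family, whether its relation holds at [n]
   turns least significant first into most significant first. *)
Lemma recognizable_automatic (k : nat) (R : nat -> Prop) : 2 <= k ->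
  recognizable k (fun x => R (x 0)) -> automatic k (fun n => `[< R n >]).
Proof.
move=> k2 [Q [q0 [step [P [P0 PD]]]]]; apply/(automaticP _ k2).
exists {set Q}, (fun n => [set q | `[< P q (fun=> n) >]]).
exists (fun (S : {set Q}) d => [set q | step q (fun=> d) \in S]).
exists (fun S : {set Q} => q0 \in S).
split=> [n d dk|n]; last by rewrite inE; apply: asbool_equiv_eq; rewrite P0.
by apply/setP=> q; rewrite !inE; apply: asbool_equiv_eq; rewrite PD.
Qed.

(** Sums the threshold indicators: $\min(s,C+1)=\min(s,C)+[C<s]$, up to $C=B$. *)
Lemma automatic_bounded (k : nat) (s : nat -> nat) (B : nat) : 2 <= k ->
  (forall n, s n <= B) -> (forall c, recognizable k (fun x => c <= s (x 0))) ->
  automatic k s.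
Proof.
move=> k2 sB rec_s.
suff aut_min : forall C, automatic k (fun n => minn (s n) C).
  by have := aut_min B; congr automatic; apply/funext => n; apply/minn_idPl.
elim=> [|C IH].
  have -> : (fun n => minn (s n) 0) = (fun=> 0) by apply/funext => n; rewrite minn0.
  exact: automatic_const.
have -> : (fun n => minn (s n) C.+1) =
    (fun n => minn (s n) C + (`[< C.+1 <= s n >] : nat)).
  by apply/funext => n; rewrite asboolb; lia.
apply: (automatic_comp2 (fun (i : nat) (b : bool) => i + b)) => //.
exact: (recognizable_automatic (R := fun n => C < s n)).
Qed.

(** * First-order description of new conjugacy classes *)

Definition window (T : Type) (f : nat -> T) (n i : nat) : n.-tuple T :=
  [tuple of mkseq (fun j => f (i + j)) n].

Definition eq_factor (T : Type) (f : nat -> T) (l i j : nat) : Prop :=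
  forall t, t < l -> f (i + t) = f (j + t).

(* Conjugacy of windows and inclusion of their classes in Fac(w), phrased with
   sums and comparisons of factors only, as needed for recognizability. *)
Definition rotated_factor (T : Type) (f : nat -> T) (r s i j : nat) : Prop :=
  eq_factor f s j (i + r) /\ eq_factor f r (j + s) i.

Definition conj_window (T : eqType) (f : nat -> T) (n i j : nat) : Prop :=
  exists r s, r + s = n /\ rotated_factor f r s i j.

Definition lie_window (T : Type) (f : nat -> T) (n i : nat) : Prop :=
  forall r s, r + s = n -> exists j, rotated_factor f r s i j.

Definition new_window (T : eqType) (f : nat -> T) (n i : nat) : Prop :=
  lie_window f n i /\ forall j, j < i -> ~ conj_window f n i j.

(** Positions are picked in decreasing order, which makes them distinct. For fixed [c] this is a
    formula with [c] quantifiers over positions, so counting stays first-order. *)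
Fixpoint atleast_new (T : eqType) (f : nat -> T) (n c m : nat) : Prop :=
  if c is c'.+1 then exists i, i < m /\ (new_window f n i /\ atleast_new f n c' i)
  else True.

Lemma recognizable_eq_factor (k : nat) (T : Type) (f : nat -> T) (l a b : nat) :
  2 <= k -> automatic k f ->
  recognizable k (fun x => eq_factor f (x l) (x a) (x b)).
Proof.
move=> k2 autf; rewrite /eq_factor; apply: recognizable_all => //=.
apply: recognizable_imply; first exact: recognizable_lt.
apply: (@recognizable_let_add k _ _ (fun x p => f p = f (x b.+1 + x 0))) => //.
apply: (@recognizable_let_add k _ _ (fun x p => f (x 0) = f p)) => //.
exact: recognizable_automatic_eq.
Qed.

Lemma recognizable_rotated_factor (k : nat) (T : Type) (f : nat -> T)
    (r s a b : nat) : 2 <= k -> automatic k f ->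
  recognizable k (fun x => rotated_factor f (x r) (x s) (x a) (x b)).
Proof.
move=> k2 autf; apply: recognizable_and.
  apply: (@recognizable_let_add k _ _ (fun x p => eq_factor f (x s) (x b) p)) => //.
  exact: recognizable_eq_factor.
apply: (@recognizable_let_add k _ _ (fun x p => eq_factor f (x r) p (x a))) => //.
exact: recognizable_eq_factor.
Qed.

Lemma recognizable_new_window (k : nat) (T : eqType) (f : nat -> T) (n a : nat) :
  2 <= k -> automatic k f -> recognizable k (fun x => new_window f (x n) (x a)).
Proof.
move=> k2 autf; rewrite /new_window /lie_window /conj_window.
apply: recognizable_and.
  do 2 apply: recognizable_all => //=.
  apply: recognizable_imply; first exact: recognizable_add.
  by apply: recognizable_ex => //=; exact: recognizable_rotated_factor.
apply: recognizable_all => //=.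
apply: recognizable_imply; first exact: recognizable_lt.
apply: recognizable_not; do 2 apply: recognizable_ex => //=.
by apply: recognizable_and; [exact: recognizable_add
                            |exact: recognizable_rotated_factor].
Qed.

Lemma recognizable_atleast_new (k : nat) (T : eqType) (f : nat -> T)
    (c n m : nat) : 2 <= k -> automatic k f ->
  recognizable k (fun x => atleast_new f (x n) c (x m)).
Proof.
move=> k2 autf; elim: c n m => [|c IH] n m /=.
  exists unit, tt, (fun _ _ => tt), (fun _ _ => True).
  by [].
apply: recognizable_ex => //=; apply: recognizable_and; first exact: recognizable_lt.
by apply: recognizable_and; [exact: recognizable_new_window|exact: IH].
Qed.

Lemma atleast_newP (T : eqType) (f : nat -> T) (n c m : nat) :
  atleast_new f n c m <->
  c <= size [seq i <- iota 0 m | `[< new_window f n i >]].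
Proof.
elim: c m => [|c IH] m //=; elim: m => [|m IHm].
  by split=> // -[i [/=]].
rewrite -addn1 iotaD filter_cat size_cat /= add0n.
split=> [[i [le_im [new_i /IH le_c]]]|].
  move: le_im; rewrite addn1 ltnS leq_eqVlt => /orP[/eqP eq_im|lt_im].
    by rewrite -eq_im; case: asboolP => // _; rewrite /= addn1 ltnS.
  by rewrite (leq_trans _ (leq_addr _ _)) //; apply/IHm; exists i; rewrite IH.
case: asboolP => /= [new_m|_].
  by rewrite !addn1 ltnS => le_c; exists m; rewrite IH.
rewrite addn0 => /IHm[i [lt_im ?]]; exists i; split=> //; lia.
Qed.

(** * Cyclic equivalence of words and of windows *)

Lemma cyc_equivP (T : eqType) (v u : seq T) :
  reflect (exists2 r, r <= size v & u = rot r v) (cyc_equiv v u).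
Proof.
apply: (iffP existsP) => [[r /eqP ->]|[r le_rv ->]].
  by exists r => //; rewrite -ltnS.
by exists (inord r); rewrite inordK.
Qed.

Lemma cyc_equiv_rot (T : eqType) (r : nat) (v : seq T) : cyc_equiv v (rot r v).
Proof.
apply/cyc_equivP; have [le_rv|lt_vr] := leqP r (size v); first by exists r.
by exists 0; rewrite // rot0 rot_oversize // ltnW.
Qed.

Lemma cyc_equiv_refl (T : eqType) (v : seq T) : cyc_equiv v v.
Proof. by have := cyc_equiv_rot 0 v; rewrite rot0. Qed.

Lemma cyc_equiv_sym (T : eqType) (v u : seq T) : cyc_equiv v u -> cyc_equiv u v.
Proof.
move=> /cyc_equivP[r _ ->]; have := cyc_equiv_rot (size (rot r v) - r) (rot r v).
by rewrite -/(rotr r _) rotK.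
Qed.

Lemma cyc_equiv_trans (T : eqType) (v u w : seq T) :
  cyc_equiv v u -> cyc_equiv u w -> cyc_equiv v w.
Proof.
move=> /cyc_equivP[r le_rv ->] /cyc_equivP[s + ->]; rewrite size_rot => le_sv.
by rewrite rot_add_mod // cyc_equiv_rot.
Qed.

Lemma cyc_class_eqP (Delta : finType) (n : nat) (v u : n.-tuple Delta) :
  reflect (cyc_class v = cyc_class u) (cyc_equiv v u).
Proof.
apply: (iffP idP) => [vu|eq_class].
  apply/setP=> w; rewrite !inE.
  by apply/idP/idP; apply: cyc_equiv_trans => //; apply: cyc_equiv_sym.
have : u \in cyc_class u by rewrite inE cyc_equiv_refl.
by rewrite -eq_class inE.
Qed.

Lemma class_in_fac_cyc (T : eqType) (f : nat -> T) (v u : seq T) :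
  cyc_equiv v u -> class_in_fac f v -> class_in_fac f u.
Proof. by move=> vu fac_v w uw; apply: fac_v; apply: cyc_equiv_trans uw. Qed.

Lemma mkseq_shift_eqP (T : Type) (f : nat -> T) (l i j : nat) :
  mkseq (fun t => f (i + t)) l = mkseq (fun t => f (j + t)) l <->
  eq_factor f l i j.
Proof.
split=> [eq_seq t lt_tl|eq_fac].
  have := congr1 (fun s => nth (f 0) s t) eq_seq.
  by rewrite !nth_mkseq.
by apply/eq_in_map => t; rewrite mem_iota => /andP[_ /eq_fac].
Qed.

Lemma mkseq_shift_cat (T : Type) (f : nat -> T) (r s i : nat) :
  mkseq (fun t => f (i + t)) (r + s) =
  mkseq (fun t => f (i + t)) r ++ mkseq (fun t => f (i + r + t)) s.
Proof.
rewrite /mkseq iotaD map_cat -[in iota _ s](addn0 (0 + r)) iotaDl -map_comp.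
by congr (_ ++ _); apply: eq_map => t /=; rewrite addnA.
Qed.

Lemma window_rotP (T : eqType) (f : nat -> T) (r s i j : nat) :
  window f (r + s) j = rot r (window f (r + s) i) :> seq T <->
  rotated_factor f r s i j.
Proof.
rewrite /= [in rot _ _]mkseq_shift_cat.
rewrite -[X in rot X](size_mkseq (fun t => f (i + t)) r).
rewrite rot_size_cat [r + s]addnC mkseq_shift_cat /rotated_factor.
rewrite -!mkseq_shift_eqP; split=> [/eqP|[-> ->]] //.
by rewrite eqseq_cat ?size_mkseq // => /andP[/eqP-> /eqP->].
Qed.

Lemma conj_windowP (T : eqType) (f : nat -> T) (n i j : nat) :
  conj_window f n i j <-> cyc_equiv (window f n i) (window f n j).
Proof.
split=> [[r [s [<- /window_rotP ->]]]|/cyc_equivP[r]]; first exact: cyc_equiv_rot.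
rewrite size_tuple => le_rn; rewrite -(subnKC le_rn) => /window_rotP rot_ij.
by exists r, (n - r); rewrite subnKC.
Qed.

Lemma is_factor_window (T : Type) (f : nat -> T) (n : nat) (v : n.-tuple T) :
  is_factor f v <-> exists i, v = window f n i.
Proof.
split=> [[i]|[i ->]]; last by exists i; rewrite size_tuple.
by rewrite size_tuple => def_v; exists i; apply: val_inj.
Qed.

Lemma class_in_fac_window (T : eqType) (f : nat -> T) (n i : nat) :
  class_in_fac f (window f n i) <-> lie_window f n i.
Proof.
split=> [fac r s def_n|lie u /cyc_equivP[r]].
  have /fac := cyc_equiv_rot r (window f n i).
  rewrite -[rot _ _]/(val (rot_tuple r (window f n i))).
  move=> /is_factor_window[j /(congr1 val) /= def_j]; exists j.
  by apply/window_rotP; subst n; rewrite def_j.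
rewrite size_tuple => le_rn ->; have [j] := lie r (n - r) (subnKC le_rn).
by move=> /window_rotP; rewrite subnKC // => <-; apply/is_factor_window; exists j.
Qed.

Lemma new_windowP (T : eqType) (f : nat -> T) (n i : nat) :
  new_window f n i <->
  class_in_fac f (window f n i) /\
  forall j, j < i -> ~~ cyc_equiv (window f n i) (window f n j).
Proof.
rewrite class_in_fac_window; split=> -[lie new]; split=> // j /new.
  by move=> nconj; apply/negP => /conj_windowP.
by move=> /negP nconj /conj_windowP.
Qed.

(** * Lie complexity as a count of new windows *)

Definition lie_classes (Delta : finType) (f : nat -> Delta) (n : nat) :
    {set {set n.-tuple Delta}} :=
  [set cyc_class v | v in [set v : n.-tuple Delta | `[< class_in_fac f v >]]].

Lemma new_window_exists (Delta : finType) (f : nat -> Delta) (n : nat)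
    (X : {set n.-tuple Delta}) :
  X \in lie_classes f n ->
  exists i, new_window f n i /\ cyc_class (window f n i) = X.
Proof.
move=> /imsetP[v /[!inE] /asboolP fac_v ->].
have ex_i : exists i, cyc_equiv v (window f n i).
  have /fac_v /is_factor_window[i def_v] := cyc_equiv_refl v.
  by exists i; rewrite -def_v cyc_equiv_refl.
have [i vi min_i] := ex_minnP ex_i; exists i; split.
  apply/new_windowP; split; first exact: class_in_fac_cyc fac_v.
  move=> j lt_ji; apply/negP => ij; have := min_i j (cyc_equiv_trans vi ij).
  by rewrite leqNgt lt_ji.
by apply/esym/cyc_class_eqP.
Qed.

(** Each class has exactly one new window, its leftmost, so the new windows below a large enough [m]
    list all classes once. *)
Lemma lie_complexity_geP (Delta : finType) (f : nat -> Delta) (n c : nat) :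
  c <= lie_complexity f n <-> exists m, atleast_new f n c m.
Proof.
rewrite -[lie_complexity f n]/(#|lie_classes f n|).
pose news m := [seq cyc_class (window f n i) |
                  i <- [seq i <- iota 0 m | `[< new_window f n i >]]].
have le_news m : size (news m) <= #|lie_classes f n|.
  have uniq_news : uniq (news m).
    rewrite map_inj_in_uniq ?filter_uniq ?iota_uniq // => i j.
    rewrite !mem_filter => /andP[/asboolP /new_windowP[_ new_i] _].
    move=> /andP[/asboolP /new_windowP[_ new_j] _] /cyc_class_eqP ij.
    have [lt_ij|lt_ji|//] := ltngtP i j.
      by have := new_j i lt_ij; rewrite cyc_equiv_sym.
    by have := new_i j lt_ji; rewrite ij.
  rewrite -(card_uniqP uniq_news); apply/subset_leq_card/subsetP => X.
  move=> /mapP[i]; rewrite mem_filter => /andP[/asboolP /new_windowP[fac_i _] _] ->.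
  by apply: imset_f; rewrite inE; apply/asboolP.
have [m ge_news] : exists m, #|lie_classes f n| <= size (news m).
  have /choice[pos posP] (X : {set n.-tuple Delta}) : exists i,
      X \in lie_classes f n -> new_window f n i /\ cyc_class (window f n i) = X.
    by have [/new_window_exists[i]|] := boolP (X \in lie_classes f n);
      [exists i|exists 0].
  exists (\max_X pos X).+1; rewrite (leq_trans _ (card_size (news _))) //.
  apply/subset_leq_card/subsetP => X /posP[new_X <-].
  apply: map_f; rewrite mem_filter; apply/andP; split; first exact/asboolP.
  by rewrite mem_iota ltnS leq_bigmax.
split=> [le_c|[m' /atleast_newP]].
  exists m; apply/atleast_newP; apply: leq_trans le_c _.
  by move: ge_news; rewrite size_map.
by move=> le_c; rewrite (leq_trans _ (le_news m')) // size_map.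
Qed.

Lemma recognizable_lie_complexity (k : nat) (Delta : finType)
    (f : nat -> Delta) (c : nat) : 2 <= k -> automatic k f ->
  recognizable k (fun x => c <= lie_complexity f (x 0)).
Proof.
move=> k2 autf.
apply: (@recognizable_ext _ (fun x => exists m, atleast_new f (x 0) c m)).
  by move=> x; rewrite lie_complexity_geP.
by apply: recognizable_ex => //=; exact: recognizable_atleast_new.
Qed.

(** * Linear bound on the number of factors *)

(** Reads [m] digits at once: in an aligned block of length $k^m$, states depend only on the state
    of the block's index and on the offset. *)
Lemma digit_recursive_block (k : nat) (Q : Type) (st : nat -> Q)
    (delta : Q -> nat -> Q) (m : nat) :
  (forall n d, d < k -> st (k * n + d) = delta (st n) d) ->
  exists g : Q -> nat -> Q,
    forall a r, r < k ^ m -> st (k ^ m * a + r) = g (st a) r.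
Proof.
move=> stD; elim: m => [|m [g stg]].
  by exists (fun q _ => q) => a [|r] //; rewrite mul1n addn0.
exists (fun q r => g (delta q (r %/ k ^ m)) (r %% k ^ m)) => a r lt_r.
have km_gt0 : 0 < k ^ m by move: lt_r; rewrite expnS; case: (k ^ m); lia.
rewrite -stD; last by rewrite ltn_divLR // -expnS.
rewrite -stg ?ltn_mod // {1}(divn_eq r (k ^ m)); congr st.
by rewrite expnSr mulnDr mulnA addnA [r %/ _ * _]mulnC.
Qed.

Definition factors (Delta : finType) (f : nat -> Delta) (n : nat) :
    {set n.-tuple Delta} := [set x : n.-tuple Delta | `[< is_factor f x >]].

Lemma card_factors (k : nat) (Delta : finType) (f : nat -> Delta) :
  2 <= k -> automatic k f ->
  exists C, forall n, 0 < n -> #|factors f n| <= C * n.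
Proof.
move=> k2 /(automaticP _ k2) [Q [st [delta [tau [stD fE]]]]].
exists (#|Q| * #|Q| * k) => n n_gt0.
(* Here $k^m\le n<k^{m+1}=K$, so $K\le kn$: the offset takes at most $kn$ values, whence the factor
   [k] in the constant. *)
have /andP[] := trunc_log_bounds k2 n_gt0; set m := trunc_log k n.
rewrite expnS => le_n lt_n; have [g stg] := digit_recursive_block m.+1 stD.
rewrite expnS in stg; set K := k * k ^ m in lt_n stg *.
(* A factor of length [n <= K] meets at most two consecutive [K]-blocks; it is
   determined by the states of these blocks and its offset in the first one. *)
pose dec (u : Q * Q * 'I_K) : n.-tuple Delta :=
  [tuple of mkseq (fun j => if u.2 + j < K then tau (g u.1.1 (u.2 + j))
                            else tau (g u.1.2 (u.2 + j - K))) n].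
have K_gt0 : 0 < K by lia.
have sub_dec : factors f n \subset [set dec u | u in setT].
  apply/subsetP => x /[!inE] /asboolP /is_factor_window[i ->].
  pose u := (st (i %/ K), st (i %/ K).+1, Ordinal (ltn_pmod i K_gt0)).
  apply/imsetP; exists u => //; apply/val_inj/eq_in_map => j.
  rewrite mem_iota => lt_jn /=; rewrite -fE {1}(divn_eq i K) mulnC -addnA.
  have lt_mod := ltn_pmod i K_gt0.
  case: ltnP => [lt_K|ge_K]; first by rewrite -stg.
  rewrite -stg; last by lia.
  by congr (tau (st _)); rewrite mulnS; lia.
rewrite (leq_trans (subset_leq_card sub_dec)) // (leq_trans (leq_imset_card _ _)) //.
by rewrite cardsT !card_prod card_ord -[_ * k * n]mulnA !leq_mul.
Qed.

(** * Periodic words *)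

(** The infinite word $vvv\cdots$, on which rotations become shifts. The default [x0] is reached
    only when [v] is empty. *)
Definition periodize (T : Type) (x0 : T) (v : seq T) (i : nat) : T :=
  nth x0 v (i %% size v).

Lemma periodizeD (T : Type) (x0 : T) (v : seq T) (i a : nat) :
  periodize x0 v (i + a * size v) = periodize x0 v i.
Proof. by rewrite /periodize addnC modnMDl. Qed.

Lemma rot_periodize (T : Type) (x0 : T) (v : seq T) (a : nat) : 0 < size v ->
  rot (a %% size v) v = mkseq (fun j => periodize x0 v (a + j)) (size v).
Proof.
move=> v_gt0; apply: (@eq_from_nth _ x0) => [|i]; rewrite size_rot ?size_mkseq //.
move=> lt_i; rewrite nth_mkseq // /periodize -modnDml.
have lt_b := ltn_pmod a v_gt0; set b := a %% _ in lt_b *.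
rewrite nth_cat size_drop nth_drop; case: ltnP => [lt_n|ge_n].
  by rewrite modn_small //; lia.
rewrite nth_take; last by lia.
have -> : b + i = i - (size v - b) + size v by lia.
by rewrite modnDr modn_small //; lia.
Qed.

Lemma eq_periodize (T : Type) (x0 : T) (n : nat) (v u : seq T) (a b : nat) :
  0 < n -> size v = n -> size u = n ->
  (forall j, j < n -> periodize x0 v (a + j) = periodize x0 u (b + j)) ->
  forall j, periodize x0 v (a + j) = periodize x0 u (b + j).
Proof.
move=> n_gt0 vn un eq_vu j; have := eq_vu _ (ltn_pmod j n_gt0).
by rewrite /periodize vn un !modnDmr.
Qed.

Lemma cyc_equiv_periodize (T : eqType) (x0 : T) (n : nat) (v u : seq T)
    (a b : nat) : 0 < n -> size v = n -> size u = n ->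
  (forall j, j < n -> periodize x0 v (a + j) = periodize x0 u (b + j)) ->
  cyc_equiv v u.
Proof.
move=> n_gt0 vn un eq_vu.
have rot_vu : rot (a %% n) v = rot (b %% n) u.
  rewrite -{1}vn -un !(rot_periodize x0) ?vn ?un //.
  by apply/eq_in_map => j; rewrite mem_iota => /andP[_ /eq_vu].
apply: (cyc_equiv_trans (cyc_equiv_rot (a %% n) v)).
by rewrite rot_vu cyc_equiv_sym // cyc_equiv_rot.
Qed.

(* A weak Fine-Wilf theorem. *)
Lemma eq_of_periods (T : Type) (s u : nat -> T) (d e : nat) :
  0 < d -> 0 < e -> (forall i, s (i + d) = s i) -> (forall i, u (i + e) = u i) ->
  (forall i, i < d + e -> s i = u i) -> forall i, s i = u i.
Proof.
move=> d_gt0 e_gt0 sd ue su.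
have mulp (w : nat -> T) p a i : (forall i, w (i + p) = w i) -> w (i + a * p) = w i.
  by move=> wp; elim: a => [|a IH]; rewrite ?addn0 // mulSn addnCA addnC wp.
have modp (w : nat -> T) p i : (forall i, w (i + p) = w i) -> w i = w (i %% p).
  by move=> wp; rewrite {1}(divn_eq i p) addnC mulp.
(* The word [s] inherits the period [e]: reduce [i] modulo [d], pass to [u], drop [e] and return,
   with all indices below [d + e]. *)
have se i : s (i + e) = s i.
  have lt_mod := ltn_pmod i d_gt0.
  rewrite {1}(divn_eq i d) -addnA addnC mulp // [RHS](modp _ d) //.
  rewrite su; last by lia.
  by rewrite ue -su //; lia.
move=> i; rewrite (modp s e) // (modp u e) // su //.
by have := ltn_pmod i e_gt0; lia.
Qed.

(** * Counting in finite sets *)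

(** The pairs [(v, t)] inject into [F]. A relation instead of a function leaves the choice of the
    attached element to this proof. *)
Lemma card_mul_le (I T : finType) (S : {set I}) (F : {set T}) (h : nat)
    (rel : I -> nat -> T -> Prop) :
  (forall v t, v \in S -> t < h -> exists2 x, x \in F & rel v t x) ->
  (forall v t u r x, v \in S -> u \in S -> t < h -> r < h ->
     rel v t x -> rel u r x -> v = u /\ t = r) ->
  #|S| * h <= #|F|.
Proof.
move=> relF rel_inj.
pose g (u : I * 'I_h) := [pick x in F | `[< rel u.1 u.2 x >]].
have gP u : u.1 \in S -> exists2 x, x \in F & g u = Some x /\ rel u.1 u.2 x.
  move=> uS; rewrite /g; case: pickP => [x /andP[xF /asboolP]|no_x].
    by exists x.
  have [x xF rel_x] := relF _ _ uS (ltn_ord u.2).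
  by have := no_x x; rewrite xF; case: asboolP.
have g_inj : {in setX S setT &, injective g}.
  move=> [v t] [u r]; rewrite !inE /= !andbT => vS uS eq_g.
  have [x _ [gx rel_x]] := gP (v, t) vS.
  have [y _ [gy rel_y]] := gP (u, r) uS.
  have eq_xy : y = x by apply: Some_inj; rewrite -gx -gy.
  rewrite eq_xy in rel_y; have [-> eq_tr] :=
    rel_inj _ _ _ _ _ vS uS (ltn_ord t) (ltn_ord r) rel_x rel_y.
  by congr (_, _); apply: val_inj.
have := card_in_imset g_inj; rewrite cardsX cardsT card_ord => <-.
have inj_some : injective (@Some T) by move=> x y [].
rewrite -(card_imset (mem F) inj_some); apply/subset_leq_card/subsetP => y.
move=> /imsetP[u uS ->]; have [|x xF [-> _]] := gP u; last exact: imset_f.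
by move: uS; rewrite !inE andbT.
Qed.

(** The result of [pick] depends only on the fibre of [g], so exactly one element of each nonempty
    fibre in [V] is its own pick. *)
Lemma imset_representatives (I T : finType) (g : I -> T) (V : {set I}) :
  exists R : {set I}, [/\ R \subset V, {in R &, injective g} & #|g @: V| = #|R|].
Proof.
pose R := [set v in V | [pick u in V | g u == g v] == Some v].
have g_inj : {in R &, injective g}.
  move=> v u /[!inE] /andP[_ /eqP pv] /andP[_ /eqP pu] eq_g.
  by apply: Some_inj; rewrite -pv -pu eq_g.
exists R; split=> //; first by apply/subsetP => v /[!inE] /andP[].
rewrite -(card_in_imset g_inj); apply: eq_card => X.
apply/imsetP/imsetP => -[v vV ->]; last first.
  by exists v => //; move: vV; rewrite inE => /andP[].
case def_p: [pick u in V | g u == g v] => [u|]; have := def_p; case: pickP => //.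
  move=> w /andP[wV /eqP eq_g] [eq_wu]; rewrite {}eq_wu in wV eq_g.
  by exists u; rewrite // inE wV eq_g def_p /=.
by move=> /(_ v); rewrite vV eqxx.
Qed.

(** * Boundedness of the Lie complexity *)

Lemma lie_complexity_bounded (k : nat) (Delta : finType) (f : nat -> Delta) :
  2 <= k -> automatic k f -> exists B, forall n, lie_complexity f n <= B.
Proof.
move=> k2 autf; have [C card_fac] := card_factors k2 autf.
(* The sets [A] and [S] below have at most [4 * C] elements each, as $|A|h,|S|h\le Cn$ and $n<4h$;
   [E] has at most one. *)
exists (8 * C + 1) => n; have [->|n_gt0] := posnP n.
  rewrite (leq_trans (leq_imset_card _ _)) // (leq_trans (max_card _)) //.
  by rewrite card_tuple expn0; lia.
rewrite /lie_complexity; set V := [set v : n.-tuple Delta | _].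
have [R [RV class_inj ->]] := imset_representatives (@cyc_class Delta n) V.
pose per (v : n.-tuple Delta) := periodize (f 0) v.
have per_n v i c : per v (i + c * n) = per v i.
  by have := periodizeD (f 0) v i c; rewrite size_tuple.
have eq_per (v u : n.-tuple Delta) a b :
    (forall j, j < n -> per v (a + j) = per u (b + j)) ->
    forall j, per v (a + j) = per u (b + j).
  exact: eq_periodize n_gt0 (size_tuple v) (size_tuple u).
have eq_rep v u a b : v \in R -> u \in R ->
    (forall j, per v (a + j) = per u (b + j)) -> v = u.
  move=> vR uR eq_vu; apply: class_inj => //; apply/cyc_class_eqP.
  apply: (cyc_equiv_periodize n_gt0 (size_tuple v) (size_tuple u)) => j _.
  exact: eq_vu.
have fac_R v u : v \in R -> cyc_equiv v u -> is_factor f u.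
  by move=> /(subsetP RV) /[!inE] /asboolP; apply.
(* Numbers below [h] are at most $n/4$, so two periods and a cut still fit in length [n] for
   Fine-Wilf, while $n<4h$ serves the count. *)
pose h := (n %/ 4).+1; have le_hn : h <= n by rewrite /h; lia.
pose short v := exists2 d, 0 < d < h & forall i, per v (i + d) = per v i.
pose tail v := exists i, forall j, f (i + j) = per v j.
pose A := [set v in R | ~~ `[< short v >]].
pose E := [set v in R | `[< tail v >]].
pose S := [set v in R | `[< short v >] && ~~ `[< tail v >]].
have cardA : #|A| * h <= #|factors f n|.
  have short_diff v t r : t < r -> r < h ->
      (forall j, per v (t + j) = per v (r + j)) -> short v.
    move=> lt_tr lt_rh eq_tr; exists (r - t) => [|i]; first by lia.
    (* Adding [t * n], a multiple of the period [n], brings the index to at least [t], where the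
       equality of shifts applies. *)
    have le_tn : t <= t * n by rewrite leq_pmulr.
    rewrite -(per_n v i t) -(per_n v (i + (r - t)) t).
    rewrite -{2}(subnKC le_tn) addnCA eq_tr; congr per; lia.
  (* The factor attached to [t] is the rotation of [v] by [t]; two equal ones for $t<r<h$ would give
     the short period $r-t$. *)
  apply: (@card_mul_le _ _ _ _ _ (fun v t (x : n.-tuple Delta) =>
    forall j, j < n -> nth (f 0) x j = per v (t + j))).
    move=> v t /[!inE] /andP[vR _] lt_th; exists (rot_tuple t v) => [|j lt_jn].
      by rewrite inE; apply/asboolP/(fac_R v)/cyc_equiv_rot.
    have lt_tn : t < n by lia.
    have := @rot_periodize _ (f 0) v t; rewrite size_tuple modn_small // => /= -> //.
    by rewrite nth_mkseq.
  move=> v t u r x /[!inE] /andP[vR /asboolP nshort_v] /andP[uR _] lt_th lt_rh.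
  move=> xv xu; have eq_vu : forall j, per v (t + j) = per u (r + j).
    by apply: eq_per => j lt_jn; rewrite -xv // xu.
  have eqvu := eq_rep _ _ _ _ vR uR eq_vu; split=> //; rewrite -eqvu in eq_vu.
  have [lt_tr|lt_rt|//] := ltngtP t r; case: nshort_v.
    exact: (short_diff v t r).
  by apply: (short_diff v r t) => // j; rewrite eq_vu.
have cardS : #|S| * h <= #|factors f n|.
  (* The factor attached to [t] follows a shift of $vvv\cdots$ until index [n - t.+1], where it
     first deviates. *)
  apply: (@card_mul_le _ _ _ _ _ (fun v t (x : n.-tuple Delta) => exists a,
    (forall j, j < n - t.+1 -> nth (f 0) x j = per v (a + j)) /\
    nth (f 0) x (n - t.+1) <> per v (a + (n - t.+1)))).
    move=> v t /[!inE] /and3P[vR _ /asboolP ntail_v] lt_th.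
    have /is_factor_window[i def_v] := fac_R v v vR (cyc_equiv_refl v).
    have per_v j : j < n -> f (i + j) = per v j.
      by move=> lt_jn; rewrite /per /periodize size_tuple modn_small // def_v nth_mkseq.
    have ex_j : exists j, f (i + j) != per v j.
      apply: contrapT => all_j; apply: ntail_v; exists i => j.
      by apply/eqP/negPn/negP => ne_j; apply: all_j; exists j.
    have [J /eqP neJ minJ] := ex_minnP ex_j.
    (* The first [n] letters are those of [v], so the break [J] comes later and the subtraction
       defining [a] is not truncated. *)
    have le_nJ : n <= J by rewrite leqNgt; apply/negP => /per_v.
    pose a := J - (n - t.+1); exists (window f n (i + a)).
      by rewrite inE; apply/asboolP/is_factor_window; exists (i + a).
    exists a; split=> [j lt_j|]; (rewrite nth_mkseq; last by lia).
      apply/eqP/negPn/negP; rewrite -addnA => /minJ; rewrite /a; lia.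
    by rewrite -addnA /a subnK //; lia.
  move=> v t u r x /[!inE] /and3P[vR /asboolP[d d_h vd] _].
  move=> /and3P[uR /asboolP[e e_h ue] _] lt_th lt_rh [a [xv xv']] [b [xu xu']].
  (* The common prefix has length $n-\max(t,r)-1$, which is at least $d+e$ because $d,e,t,r\le n/4$
     and $d\ge1$. *)
  have eq_vu : forall j, per v (a + j) = per u (b + j).
    apply: (@eq_of_periods _ _ _ d e) => [||i|i|i lt_i]; try lia.
    - by rewrite addnA vd.
    - by rewrite addnA ue.
    by rewrite -xv ?xu //; rewrite /h in d_h e_h lt_th lt_rh; lia.
  have eqvu := eq_rep _ _ _ _ vR uR eq_vu; split=> //.
  (* If the breaks differed, the earlier one would fall where [x] still follows the other periodic
     word, which is the same. *)
  have [lt_tr|lt_rt|//] := ltngtP t r.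
    by case: xu'; rewrite xv ?eq_vu //; lia.
  by case: xv'; rewrite xu ?eq_vu //; lia.
have cardE : #|E| <= 1.
  apply/card_le1_eqP => v u /[!inE] /andP[vR /asboolP[i vi]] /andP[uR /asboolP[j uj]].
  (* Shifting each periodic word by the starting position of the other aligns both at $i+j$ in
     [f]. *)
  apply: (eq_rep _ _ i j) => // l; by rewrite -vi -uj addnCA.
have cardR : #|R| <= #|A| + #|S| + #|E|.
  have -> : R = A :|: S :|: E.
    by apply/setP=> w; rewrite !inE; do 2 case: asboolP => _; case: (w \in R).
  rewrite (leq_trans (leq_card_setU _ _)) // leq_add2r.
  exact: leq_card_setU.
have := card_fac n n_gt0; rewrite /h in cardA cardS; nia.
Qed.

Theorem theorem4 (k : nat) (Delta : finType) (f : nat -> Delta) :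
  2 <= k -> automatic k f -> automatic k (lie_complexity f).
Proof.
move=> k2 autf; have [B lieB] := lie_complexity_bounded k2 autf.
by apply: (automatic_bounded k2 lieB) => c; apply: recognizable_lie_complexity.
Qed.
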